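(* Let $U\subset\mathbb{C}$ be the open unit disc. There exists $g\in H^1(U)$ such that the sequence of partial sums $\left(S_N g\right)_{N}$ does not converge in $H^1(U)$ (i.e. in the norm $\|\cdot\|_{H^1(U)}$).
   Context: $U=\{z\in\mathbb{C}:|z|<1\}$ and $\mathcal{O}(U)$ is the set of holomorphic functions on $U$. The Hardy space $H^1(U)$ is the set of $f\in\mathcal{O}(U)$ such that $$\|f\|_{H^1(U)}=\sup_{0\le r<1}\frac{1}{2\pi}\int_0^{2\pi}|f(re^{i\theta})|\,d\theta<\infty,$$ where $d\theta$ is Lebesgue measure on $[0,2\pi]$. For $h\in\mathcal{O}(U)$ with power series $h(z)=\sum_{k=0}^\infty a_kz^k$ and $N\in\mathbb{Z}^+$, $S_Nh(z)=\sum_{k=0}^N a_kz^k$ denotes the $N$-th partial sum of $h$. *)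

(* Defs.v *)
From HB Require Import structures.
From mathcomp Require Import all_boot all_order all_algebra.
From mathcomp Require Import all_classical all_reals all_analysis.
From mathcomp Require Import complex.
Set Implicit Arguments.
Unset Strict Implicit.
Unset Printing Implicit Defensive.
Import Order.TTheory GRing.Theory Num.Theory.
Import numFieldNormedType.Exports.
Local Open Scope classical_set_scope.
Local Open Scope ring_scope.
Local Open Scope complex_scope.

(* [R[i]^o] is [R[i]] seen as a normed space over itself: its topology is that
   of the complex modulus, and derivatives in it are complex derivatives. *)
Notation Cplx R := (R[i]^o).

Definition unit_disc (R : realType) : set (Cplx R) :=
  [set z | `|z| < 1].

Definition holomorphic_on (R : realType) (D : set (Cplx R))
    (f : Cplx R -> Cplx R) : Prop :=
  forall z, D z -> derivable f z 1.

Definition circle_point (R : realType) (r t : R) : Cplx R :=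
  (r * cos t) +i* (r * sin t).

(* The modulus [`|z|] lives in [R[i]] (with zero imaginary part), hence [Re]. *)
Definition hardy_norm (R : realType) (f : Cplx R -> Cplx R) : \bar R :=
  ereal_sup
    [set (((2 * pi)^-1)%:E *
          \int[lebesgue_measure]_(t in `[0%R, (2 * pi)%R])
             (complex.Re `|f (circle_point r t)|)%:E)%E
    | r in [set r : R | 0 <= r < 1]].

(* Only the values of [f] on the disc matter. *)
Definition hardy_space (R : realType) : set (Cplx R -> Cplx R) :=
  [set f | holomorphic_on (@unit_disc R) f /\ (hardy_norm f < +oo)%E].

Definition has_power_series (R : realType) (h : Cplx R -> Cplx R)
    (a : nat -> Cplx R) : Prop :=
  forall z, unit_disc z ->
    (fun n => \sum_(0 <= k < n) (a k * z ^+ k : Cplx R)) @ \oo --> h z.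

Definition partial_sum (R : realType) (a : nat -> Cplx R) (N : nat) :
    Cplx R -> Cplx R :=
  fun z => \sum_(0 <= k < N.+1) a k * z ^+ k.

Definition converges_in_hardy (R : realType)
    (F : nat -> Cplx R -> Cplx R) : Prop :=
  exists h, hardy_space h /\
    (fun N => hardy_norm (fun z => F N z - h z)) @ \oo --> 0%E.

(* Main.v *)
Require Import Defs.
From HB Require Import structures.
From mathcomp Require Import all_boot all_order all_algebra.
From mathcomp Require Import all_classical all_reals all_analysis.
From mathcomp Require Import complex.
From mathcomp Require Import zify ring lra.

Set Implicit Arguments.
Unset Strict Implicit.
Unset Printing Implicit Defensive.
Import Order.TTheory GRing.Theory Num.Theory.
Import numFieldNormedType.Exports.
Import Normc.
Local Open Scope classical_set_scope.
Local Open Scope ring_scope.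
Local Open Scope complex_scope.

(** The function is a lacunary sum of shifted Fejer kernels.  With
    M = 2 ^ 2 ^ j, the polynomial

      B_j(z) = z ^ (2 M) (1 + z + ... + z ^ (M - 1)) ^ 2 / M

    has L^1 mean at most 1 on every circle of radius at most 1, because its
    modulus is at most |1 + ... + z ^ (M - 1)| ^ 2 / M, whose mean is computed
    by Parseval ([circle_int_dirichlet]).  Its exponents lie in [2 M, 4 M), and
    these ranges are disjoint for different j.  The sum g of the 2^-j B_j
    therefore has bounded Taylor coefficients and is in H^1
    ([example_hardy]).

    Cutting g in the middle of a block separates the rising half of the
    triangular coefficient sequence of B_j from its falling half, and such a
    half has a large norm.  The difference of two partial sums of g is

      2^-j z ^ (2 M) (1 + 2 z + ... + M z ^ (M - 1)) / M.

    Read from the top exponent downwards, its coefficients are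
    2^-j (M - l) / M for 0 <= l < M, and Hardy's inequality ([hardy_pairing])
    bounds its mean over circles of radius close to 1 below by a constant times
    2^-j (1 + 1/2 + ... + 1/(M - 1) - 1), which is of order 2^-j log M.  The
    size of M makes log M of order 2^j, so that these differences stay away
    from 0 ([example_window_ge]) and the partial sums are not Cauchy in
    H^1. *)

(** * The complex modulus as a real number *)

Section Modulus.
Variable R : realType.
Implicit Types z w : Cplx R.

Lemma normc_ge0 z : 0 <= normc z.
Proof. by case: z => a b; exact: sqrtr_ge0. Qed.

Lemma normE_normc z : `|z| = (normc z)%:C.
Proof. by []. Qed.

Lemma normcX z n : normc (z ^+ n) = normc z ^+ n.
Proof.
elim: n => [|n IH]; first by rewrite !expr0 normc1.
by rewrite !exprS normcM IH.
Qed.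

Lemma normcB z w : normc (z - w) = normc (w - z).
Proof. by rewrite -normcN opprB. Qed.

Lemma normc_real (x : R) : 0 <= x -> normc x%:C = x.
Proof. by move=> x0; rewrite /= expr0n addr0 sqrtr_sqr ger0_norm. Qed.

Lemma le_normc_sum (I : Type) (s : seq I) (P : pred I) (f : I -> Cplx R) :
  normc (\sum_(i <- s | P i) f i) <= \sum_(i <- s | P i) normc (f i).
Proof.
elim/big_ind2: _ => //; first by rewrite normc0.
by move=> a b c d ab cd; apply: (le_trans (le_normcD _ _)); exact: lerD.
Qed.

Lemma ler_Im_normc z : `|complex.Im z| <= normc z.
Proof.
case: z => a b /=; rewrite -sqrtr_sqr ler_wsqrtr// lerDr; exact: sqr_ge0.
Qed.

Lemma ler_Re_normc z : `|complex.Re z| <= normc z.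
Proof.
case: z => a b /=; rewrite -sqrtr_sqr ler_wsqrtr// lerDl; exact: sqr_ge0.
Qed.

Lemma normc_le_ReIm z : normc z <= `|complex.Re z| + `|complex.Im z|.
Proof.
rewrite [z]complexE; apply: le_trans (le_normcD _ _) _.
case: z => a b; rewrite normcM /= !expr0n !addr0 add0r expr1n sqrtr1 mul1r.
by rewrite !sqrtr_sqr !mul0r !mul1r !oppr0 !add0r !addr0.
Qed.

(** Distances in the complex plane take their values in the complex numbers;
    this reduces complex limits to real ones. *)
Lemma cvg_normcP (T : Type) (F : set_system T) {FF : Filter F}
    (f : T -> Cplx R) (l : Cplx R) :
  (f @ F --> l) <-> ((fun x => normc (f x - l)) @ F --> (0 : R)).
Proof.
split=> [/cvgrPdist_lt fl|/cvgrPdist_lt fl].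
- apply/cvgrPdist_lt => e e0; have := fl e%:C; rewrite ltcR => /(_ e0).
  apply: filterS => x; rewrite normE_normc ltcR sub0r normrN normcB.
  by rewrite ger0_norm// normc_ge0.
- apply/cvgrPdist_lt => e e0.
  have eE : e = (complex.Re e)%:C by rewrite RRe_real// gtr0_real.
  have := fl (complex.Re e); rewrite -ltcR -eE => /(_ e0).
  apply: filterS => x; rewrite sub0r normrN ger0_norm ?normc_ge0//.
  by rewrite normE_normc eE ltcR normcB.
Qed.

Lemma cvg_normc_squeeze (T : Type) (F : set_system T) {FF : Filter F}
    (f : T -> Cplx R) (l : Cplx R) (u : T -> R) :
  (\forall x \near F, normc (f x - l) <= u x) -> u @ F --> (0 : R) ->
  f @ F --> l.
Proof.
move=> fu u0; apply/cvg_normcP.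
apply: (squeeze_cvgr _ (cvg_cst 0) u0).
by apply: filterS fu => x ->; rewrite normc_ge0.
Qed.

Lemma cvg_normc (T : Type) (F : set_system T) {FF : Filter F}
    (f : T -> Cplx R) (l : Cplx R) :
  f @ F --> l -> (fun x => normc (f x)) @ F --> normc l.
Proof.
move=> /cvg_normcP fl; apply/cvgrPdist_le => e e0.
move/cvgrPdist_le : fl => /(_ _ e0); apply: filterS => x.
rewrite sub0r normrN ger0_norm ?normc_ge0//; apply: le_trans.
by rewrite normcB; exact: (@ler_dist_dist _ (Rcomplex R)).
Qed.
End Modulus.

(** * Power series with bounded coefficients *)

Section PowerSeries.
Variable R : realType.
Implicit Types (a : nat -> Cplx R) (C : R) (z w : Cplx R).

Lemma sum_geometric_le (x : R) n m : 0 <= x < 1 -> (n <= m)%N ->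
  \sum_(n <= k < m) x ^+ k <= x ^+ n / (1 - x).
Proof.
move=> /andP[x0 x1] nm; rewrite ler_pdivlMr ?subr_gt0// mulr_suml.
under eq_bigr do rewrite mulrBr mulr1 -exprSr -opprB.
rewrite sumrN telescope_sumr// opprB gerBl; exact: exprn_ge0.
Qed.

Definition psum a n z : Cplx R := \sum_(0 <= k < n) a k * z ^+ k.

Definition power_sum a z : Cplx R := lim (psum a n z @[n --> \oo]).

Lemma psum_tail a C n m z : (forall k, normc (a k) <= C) -> normc z < 1 ->
  (n <= m)%N ->
  normc (psum a m z - psum a n z) <= C * normc z ^+ n / (1 - normc z).
Proof.
move=> aC z1 nm; have C0 : 0 <= C := le_trans (normc_ge0 _) (aC 0%N).
have -> : psum a m z - psum a n z = \sum_(n <= k < m) a k * z ^+ k.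
  by rewrite /psum (big_cat_nat (leq0n n) nm)/= addrAC subrr add0r.
apply: le_trans (le_normc_sum _ _ _) _; rewrite -mulrA.
apply: (@le_trans _ _ (C * \sum_(n <= k < m) normc z ^+ k)).
  rewrite mulr_sumr; apply: ler_sum => k _.
  by rewrite normcM normcX ler_wpM2r// exprn_ge0// normc_ge0.
by rewrite ler_wpM2l// sum_geometric_le// normc_ge0.
Qed.

(** The limit is assembled from those of the real and imaginary parts, which
    are real series dominated by a geometric one. *)
Lemma psum_cvg a C z : (forall k, normc (a k) <= C) -> normc z < 1 ->
  psum a n z @[n --> \oo] --> power_sum a z.
Proof.
move=> aC z1; have C0 : 0 <= C := le_trans (normc_ge0 _) (aC 0%N).
have dom (u : R^nat) : (forall k, `|u k| <= normc (a k * z ^+ k)) ->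
    cvgn (series u).
  move=> uk; apply: (@normed_cvg _ R^o).
  apply: (@series_le_cvg _ _ (geometric C (normc z))).
  - by move=> n; exact: normr_ge0.
  - by move=> n; rewrite /geometric/= mulr_ge0// exprn_ge0// normc_ge0.
  - move=> n; apply: (le_trans (uk n)); rewrite normcM normcX.
    by rewrite ler_wpM2r// exprn_ge0// normc_ge0.
  - by apply: is_cvg_geometric_series; rewrite ger0_norm// normc_ge0.
pose u k := complex.Re (a k * z ^+ k); pose v k := complex.Im (a k * z ^+ k).
have cu : cvgn (series u) by apply: dom => k; exact: ler_Re_normc.
have cv : cvgn (series v) by apply: dom => k; exact: ler_Im_normc.
suff psl : psum a n z @[n --> \oo] -->
    (limn (series u) +i* limn (series v) : Cplx R).
  by rewrite /power_sum (cvg_lim _ psl)//; exact: norm_hausdorff.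
have psE n : psum a n z = series u n +i* series v n.
  rewrite /psum /series; elim: n => [|n IH] /=; first by rewrite !big_geq.
  by rewrite !big_nat_recr//= IH /u /v; case: (a n * z ^+ n).
apply: (@cvg_normc_squeeze _ _ _ _ _ _
  (fun n => `|series u n - limn (series u)| + `|series v n - limn (series v)|)).
  by apply: nearW => n; rewrite psE; exact: normc_le_ReIm.
rewrite -(addr0 (0 : R)); apply: cvgD.
- rewrite -(@normr0 _ R); apply: (@cvg_norm _ R^o).
  by rewrite -(subrr (limn (series u))); apply: cvgB => //; exact: cvg_cst.
- rewrite -(@normr0 _ R); apply: (@cvg_norm _ R^o).
  by rewrite -(subrr (limn (series v))); apply: cvgB => //; exact: cvg_cst.
Qed.

Lemma power_sum_tail a C n z : (forall k, normc (a k) <= C) -> normc z < 1 ->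
  normc (power_sum a z - psum a n z) <= C * normc z ^+ n / (1 - normc z).
Proof.
move=> aC z1; have cz := psum_cvg aC z1.
have H : psum a m z - psum a n z @[m --> \oo] --> power_sum a z - psum a n z.
  by apply: cvgB => //; exact: cvg_cst.
apply: (cvgr_to_le (cvg_normc H)); exists n => // m /= nm.
exact: psum_tail.
Qed.

Lemma power_sum_bound a C z : (forall k, normc (a k) <= C) -> normc z < 1 ->
  normc (power_sum a z) <= C / (1 - normc z).
Proof.
move=> aC z1; have := power_sum_tail 0 aC z1.
by rewrite /psum big_geq// subr0 expr0 mulr1.
Qed.

(** Taylor coefficients of the difference quotient
    w |-> (f w - f z) / (w - z) of f = power_sum a. *)
Definition quotient_coefs a z : nat -> Cplx R :=
  fun i => power_sum (fun k => a (i + k).+1) z.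

Lemma quotient_coefs_bound a C z : (forall k, normc (a k) <= C) -> normc z < 1 ->
  forall i, normc (quotient_coefs a z i) <= C / (1 - normc z).
Proof. by move=> aC z1 i; exact: power_sum_bound. Qed.

Lemma power_sum_shift a C z : (forall k, normc (a k) <= C) -> normc z < 1 ->
  power_sum a z = a 0%N + z * power_sum (fun k => a k.+1) z.
Proof.
move=> aC z1.
have H1 : psum a n.+1 z @[n --> \oo] --> power_sum a z.
  by rewrite (cvg_shiftS (psum a ^~ z)); exact: psum_cvg aC z1.
have H2 : psum a n.+1 z @[n --> \oo] -->
    a 0%N + z * power_sum (fun k => a k.+1) z.
  have -> : (fun n => psum a n.+1 z) =
      fun n => a 0%N + z * psum (fun k => a k.+1) n z.
    apply: funext => n; rewrite /psum big_nat_recl// expr0 mulr1 mulr_sumr.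
    by congr (_ + _); apply: eq_bigr => k _; rewrite exprS mulrCA.
  apply: cvgD; first exact: cvg_cst.
  by apply: cvgM; [exact: cvg_cst|exact: (psum_cvg (C := C))].
exact: (cvg_unique _ H1 H2).
Qed.

(** The difference quotient at z of a power series with bounded coefficients
    is again such a series, because its coefficients b satisfy
    b i = a (i + 1) + z * b (i + 1).  Continuity at z follows, and applied to
    the quotient itself it gives the derivative. *)
Lemma power_sumB a C z w : (forall k, normc (a k) <= C) ->
    normc z < 1 -> normc w < 1 ->
  power_sum a w - power_sum a z = (w - z) * power_sum (quotient_coefs a z) w.
Proof.
move=> aC z1 w1; set b := quotient_coefs a z.
have bC := quotient_coefs_bound aC z1.
have bS i : b i = a i.+1 + z * b i.+1.
  rewrite /b /quotient_coefs (@power_sum_shift _ C)// addn0.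
  by congr (_ + _ * _); congr power_sum; apply: funext => k; rewrite addnS.
(* The telescoped identity for partial sums; its last term tends to 0. *)
have psbE n : (w - z) * psum b n w =
    psum a n.+1 w - (a 0%N + z * b 0%N) + z * b n * w ^+ n.
  elim: n => [|n IH].
    by rewrite /psum big_geq// big_nat1 !expr0; ring.
  rewrite [psum b _ _]/psum big_nat_recr//= -/(psum b n w) mulrDr IH.
  rewrite [psum a n.+2 _]/psum big_nat_recr//= -/(psum a n.+1 w).
  by rewrite exprS [b n]bS; ring.
have H1 : (w - z) * psum b n w @[n --> \oo] --> (w - z) * power_sum b w.
  by apply: cvgM; [exact: cvg_cst|exact: psum_cvg bC w1].
suff H2 : (w - z) * psum b n w @[n --> \oo] --> power_sum a w - power_sum a z.
  exact: (cvg_unique _ H2 H1).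
under eq_fun do rewrite psbE.
rewrite (power_sum_shift aC z1) -[power_sum a w - _]addr0; apply: cvgD.
  apply: cvgB; last exact: cvg_cst.
  by rewrite (cvg_shiftS (psum a ^~ w)); exact: psum_cvg aC w1.
apply: (@cvg_normc_squeeze _ _ _ _ _ _
  (geometric (normc z * (C / (1 - normc z))) (normc w))).
  apply: nearW => n; rewrite subr0 2!normcM normcX /geometric/=.
  by rewrite ler_wpM2r ?exprn_ge0 ?normc_ge0// ler_wpM2l ?normc_ge0.
by apply: cvg_geometric; rewrite ger0_norm// normc_ge0.
Qed.

Lemma near_disc z : normc z < 1 -> \forall w \near z, normc w < 1.
Proof.
move=> z1.
exact: (cvgr_lt (normc z) (@cvg_normc _ _ (nbhs z) _ id z cvg_id) 1).
Qed.

Lemma power_sum_continuous a C z : (forall k, normc (a k) <= C) ->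
  normc z < 1 -> {for z, continuous (power_sum a)}.
Proof.
move=> aC z1; have bC := quotient_coefs_bound aC z1.
apply: (@cvg_normc_squeeze _ _ (nbhs z) _ _ _
  (fun w => normc (w - z) * (C / (1 - normc z) / (1 - normc w)))).
  near=> w; have w1 : normc w < 1 by near: w; exact: near_disc.
  rewrite (power_sumB aC z1 w1) normcM ler_wpM2l ?normc_ge0//.
  exact: power_sum_bound bC w1.
rewrite -(mul0r (C / (1 - normc z) / (1 - normc z))).
apply: cvgM; first by apply/cvg_normcP; exact: cvg_id.
apply: cvgM; first exact: cvg_cst.
apply: cvgV; first by rewrite gt_eqF// subr_gt0.
by apply: cvgB; [exact: cvg_cst|apply: cvg_normc; exact: cvg_id].
Unshelve. all: by end_near. Qed.

Lemma power_sum_derivable a C z : (forall k, normc (a k) <= C) ->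
  normc z < 1 -> derivable (power_sum a) z 1.
Proof.
move=> aC z1; have bC := quotient_coefs_bound aC z1.
apply/cvg_ex; exists (power_sum (quotient_coefs a z) z).
have sz : (h + z) @[h --> (0 : Cplx R)] --> z.
  rewrite -{2}(add0r z).
  exact: (@cvgD _ _ _ (nbhs (0 : Cplx R)) _ id (cst z) 0 z cvg_id (cvg_cst _)).
have sz' : (h + z) @[h --> (0 : Cplx R)^'] --> z.
  by apply: cvg_within_filter; exact: sz.
have cb : power_sum (quotient_coefs a z) (h + z) @[h --> (0 : Cplx R)^'] -->
    power_sum (quotient_coefs a z) z.
  exact: (cvg_comp _ _ sz' (power_sum_continuous bC z1)).
apply: cvg_trans cb; apply: near_eq_cvg; near=> h.
have w1 : normc (h + z) < 1.
  by near: h; apply: (sz' [set w | normc w < 1]); exact: near_disc.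
have h0 : h != 0 by near: h; exact: nbhs_dnbhs_neq.
rewrite /= /GRing.scale/= mulr1 (power_sumB aC z1 w1) addrK.
by rewrite mulrA mulVf// mul1r.
Unshelve. all: by end_near. Qed.
End PowerSeries.

(** * Integrals of continuous functions over a period *)

Section CircleIntegral.
Variable R : realType.
Implicit Types (f g F : R -> R).
Local Notation mu := (@lebesgue_measure R).

Definition circle_int f : R := \int[mu]_(t in `[0, 2 * pi]) f t.

Lemma two_pi_gt0 : 0 < 2 * pi :> R.
Proof. by rewrite mulr_gt0// pi_gt0. Qed.

Lemma continuous_integrable f : continuous f ->
  mu.-integrable `[0, 2 * pi] (EFin \o f).
Proof.
move=> cf; apply: continuous_compact_integrable; first exact: segment_compact.
exact: continuous_subspaceT.
Qed.

Lemma EFin_circle_int f : continuous f ->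
  (circle_int f)%:E = (\int[mu]_(t in `[0%R, (2 * pi)%R]) (f t)%:E)%E.
Proof.
move=> cf; rewrite /circle_int /Rintegral fineK//.
exact: integrable_fin_num (continuous_integrable cf).
Qed.

Lemma circle_intD f g : continuous f -> continuous g ->
  circle_int (fun t => f t + g t) = circle_int f + circle_int g.
Proof. by move=> cf cg; apply: RintegralD => //; exact: continuous_integrable. Qed.

Lemma circle_intZ (c : R) f : continuous f ->
  circle_int (fun t => c * f t) = c * circle_int f.
Proof. by move=> cf; apply: RintegralZl => //; exact: continuous_integrable. Qed.

Lemma circle_int_cst (c : R) : circle_int (fun=> c) = 2 * pi * c.
Proof.
rewrite /circle_int Rintegral_cst// [X in fine X]lebesgue_measure_itv/= lte_fin.
by rewrite two_pi_gt0 -EFinD/= subr0 mulrC.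
Qed.

Lemma continuous_sum (I : Type) (s : seq I) (f : I -> R -> R) :
  (forall i, continuous (f i)) -> continuous (fun t => \sum_(i <- s) f i t).
Proof.
move=> cf; elim: s => [|i s IH] t.
  by under eq_fun do rewrite big_nil; exact: cvg_cst.
by under eq_fun do rewrite big_cons; apply: cvgD; [exact: cf|exact: IH].
Qed.

Lemma circle_int_sum (I : Type) (s : seq I) (f : I -> R -> R) :
  (forall i, continuous (f i)) ->
  circle_int (fun t => \sum_(i <- s) f i t) = \sum_(i <- s) circle_int (f i).
Proof.
move=> cf; elim: s => [|i s IH].
  by under eq_fun do rewrite big_nil; rewrite big_nil circle_int_cst mulr0.
under eq_fun do rewrite big_cons.
by rewrite big_cons circle_intD ?IH//; exact: continuous_sum.
Qed.

Lemma circle_int_le f g : continuous f -> continuous g ->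
  (forall t, 0 <= t <= 2 * pi -> f t <= g t) -> circle_int f <= circle_int g.
Proof.
move=> cf cg fg.
by apply: (le_Rintegral _ (continuous_integrable cf) (continuous_integrable cg)) => //.
Qed.

Lemma circle_int_FTC f F : continuous f ->
  (forall t : R, is_derive t 1 F (f t)) ->
  circle_int f = F (2 * pi) - F 0.
Proof.
move=> cf dF.
have cF : continuous F.
  by move=> t; apply/differentiable_continuous/derivable1_diffP.
rewrite /circle_int /Rintegral (continuous_FTC2 (F := F)) ?two_pi_gt0//.
- exact: continuous_subspaceT.
- split; first by move=> t _; exact: ex_derive.
  + by apply: cvg_at_right_filter; exact: cF.
  + by apply: cvg_at_left_filter; exact: cF.
- by move=> t _; rewrite derive1E; exact: derive_val.
Qed.

Lemma sin_natpi2 n : sin (n%:R * (2 * pi)) = 0 :> R.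
Proof.
rewrite (mulr_natl pi 2).
elim: n => [|n IH]; first by rewrite mul0r sin0.
by rewrite -natr1 mulrDl mul1r sinD2pi IH.
Qed.

Lemma cos_natpi2 n : cos (n%:R * (2 * pi)) = 1 :> R.
Proof.
rewrite (mulr_natl pi 2).
elim: n => [|n IH]; first by rewrite mul0r cos0.
by rewrite -natr1 mulrDl mul1r cosD2pi IH.
Qed.

Lemma continuous_lin (x : R) : continuous (fun t : R => x * t).
Proof. by move=> t; apply: cvgM; [exact: cvg_cst|exact: cvg_id]. Qed.

Lemma continuous_cosM (x : R) : continuous (fun t : R => cos (x * t)).
Proof.
by move=> t; apply: (cvg_comp _ _ (@continuous_lin x t)); exact: continuous_cos.
Qed.

Lemma continuous_sinM (x : R) : continuous (fun t : R => sin (x * t)).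
Proof.
by move=> t; apply: (cvg_comp _ _ (@continuous_lin x t)); exact: continuous_sin.
Qed.

Lemma is_derive_linM (x t : R) : is_derive t 1 (fun t : R => x * t) x.
Proof.
by have := is_deriveZ x (is_derive_id t (1 : R)); rewrite /GRing.scale/= mulr1.
Qed.

Lemma is_derive_sinM (x t : R) :
  is_derive t 1 (fun t : R => sin (x * t)) (x * cos (x * t)).
Proof.
rewrite mulrC; exact: is_derive1_comp (is_derive_sin (x * t)) (is_derive_linM x t).
Qed.

Lemma is_derive_cosM (x t : R) :
  is_derive t 1 (fun t : R => cos (x * t)) (- x * sin (x * t)).
Proof.
rewrite mulNr mulrC -mulNr.
exact: is_derive1_comp (is_derive_cos (x * t)) (is_derive_linM x t).
Qed.

(** Orthogonality of the exponentials, in real form: the integrand is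
    cos ((k - l) t). *)
Lemma circle_int_cos (k l : nat) :
  circle_int (fun t => cos (k%:R * t) * cos (l%:R * t) +
                       sin (k%:R * t) * sin (l%:R * t)) =
  if k == l then 2 * pi else 0.
Proof.
under eq_fun do rewrite -cosB -mulrBl.
case: eqP => [->|/eqP kl].
  under eq_fun do rewrite subrr mul0r cos0.
  by rewrite circle_int_cst mulr1.
set x : R := _ - _.
have x0 : x != 0 by rewrite subr_eq0 eqr_nat.
have dF (t : R) : is_derive t 1 (fun t => x^-1 * sin (x * t)) (cos (x * t)).
  have := is_deriveZ x^-1 (is_derive_sinM x t).
  by rewrite /GRing.scale/= mulKf.
rewrite (circle_int_FTC (@continuous_cosM x) dF) mulr0 sin0 mulr0 subr0.
by rewrite /x mulrBl sinB !sin_natpi2 !mul0r mulr0 subrr mulr0.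
Qed.

(** The sawtooth pi - t has k-th sine coefficient proportional to 1 / k.  For
    k = 0 both sides vanish, since 0^-1 = 0. *)
Lemma circle_int_sawtooth_sin (k : nat) :
  circle_int (fun t => (pi - t) * sin (k%:R * t)) = 2 * pi / k%:R.
Proof.
case: k => [|k].
  under eq_fun do rewrite mul0r sin0 mulr0.
  by rewrite circle_int_cst invr0.
set x : R := k.+1%:R; have x0 : x != 0 by rewrite pnatr_eq0.
have dF (t : R) : is_derive t 1 (fun t : R =>
    - ((pi - t) * (x^-1 * cos (x * t))) - x^-1 * (x^-1 * sin (x * t)))
    ((pi - t) * sin (x * t)).
  have dp := is_deriveB (is_derive_cst (pi : R) t 1) (is_derive_id t (1 : R)).
  have dc := is_deriveZ x^-1 (is_derive_cosM x t).
  have ds := is_deriveZ x^-1 (is_deriveZ x^-1 (is_derive_sinM x t)).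
  apply: is_derive_eq (is_deriveB (is_deriveN (is_deriveM dp dc)) ds) _.
  by rewrite /= !fctE /= -[x^-1 *: cos _]/(_ * _) /GRing.scale/=; field.
rewrite (circle_int_FTC _ dF).
  by rewrite cos_natpi2 sin_natpi2 !mulr0 cos0 sin0; field.
move=> t; apply: cvgM; last exact: continuous_sinM.
by apply: cvgB; [exact: cvg_cst|exact: cvg_id].
Qed.
End CircleIntegral.

(** * Means of trigonometric polynomials over circles *)

Section CircleMeans.
Variable R : realType.
Implicit Types (r t : R) (f : Cplx R -> Cplx R).

Lemma circle_pointX r t k :
  circle_point r t ^+ k = circle_point (r ^+ k) (k%:R * t) :> Cplx R.
Proof.
elim: k => [|k IH]; first by rewrite !expr0 /circle_point mul0r cos0 sin0 mulr1 mulr0.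
rewrite exprS IH /circle_point -natr1 mulrDl mul1r cosD sinD exprS.
apply/eqP; rewrite eq_complex/=; apply/andP; split; apply/eqP; ring.
Qed.

Lemma normc_circle_point r t : 0 <= r -> normc (circle_point r t : Cplx R) = r.
Proof.
move=> r0; rewrite /circle_point /= !exprMn -mulrDr cos2Dsin2 mulr1 sqrtr_sqr.
by rewrite ger0_norm.
Qed.

Lemma sqr_normc (z : Cplx R) : normc z ^+ 2 = complex.Re z ^+ 2 + complex.Im z ^+ 2.
Proof. by case: z => a b /=; rewrite sqr_sqrtr// addr_ge0// sqr_ge0. Qed.

Lemma sum_complex (I : Type) (s : seq I) (a b : I -> R) :
  \sum_(i <- s) (a i +i* b i : Cplx R) = (\sum_(i <- s) a i) +i* (\sum_(i <- s) b i).
Proof.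
elim: s => [|i s IH]; first by rewrite !big_nil.
by rewrite !big_cons IH.
Qed.

Lemma continuous_circle_point r : continuous (fun t => circle_point r t : Cplx R).
Proof.
move=> t; apply: (@cvg_normc_squeeze _ _ (nbhs t) _ _ _
  (fun s => `|r * cos s - r * cos t| + `|r * sin s - r * sin t|)).
  by apply: nearW => s; exact: normc_le_ReIm.
rewrite -(addr0 (0 : R)); apply: cvgD.
- rewrite -(@normr0 _ R) -(subrr (r * cos t)); apply: (@cvg_norm _ R^o).
  apply: cvgB; last exact: cvg_cst.
  by apply: cvgM; [exact: cvg_cst|exact: continuous_cos].
- rewrite -(@normr0 _ R) -(subrr (r * sin t)); apply: (@cvg_norm _ R^o).
  apply: cvgB; last exact: cvg_cst.
  by apply: cvgM; [exact: cvg_cst|exact: continuous_sin].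
Qed.

Lemma continuous_expC n : continuous (fun z : Cplx R => z ^+ n : Cplx R).
Proof.
elim: n => [|n IH] z; first exact: cst_continuous.
rewrite (_ : (fun _ => _) = fun z : Cplx R => z * z ^+ n : Cplx R).
  apply: (@continuousM _ _ id (fun z : Cplx R => z ^+ n : Cplx R)).
    exact: cvg_id.
  exact: IH.
by apply: funext => x; rewrite exprS.
Qed.

Lemma continuous_monomials (I : Type) (s : seq I) (c : I -> Cplx R) (m : I -> nat) :
  continuous (fun z : Cplx R => \sum_(i <- s) c i * z ^+ m i : Cplx R).
Proof.
elim: s => [|i s IH].
  rewrite (_ : (fun _ => _) = cst 0); first exact: cst_continuous.
  by apply: funext => z; rewrite big_nil.
rewrite (_ : (fun _ => _) = fun z : Cplx R =>
  (c i * z ^+ m i : Cplx R) + (\sum_(j <- s) c j * z ^+ m j : Cplx R)).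
  move=> z; apply: (@continuousD _ _ _ (fun z : Cplx R => c i * z ^+ m i : Cplx R)
    (fun z : Cplx R => \sum_(j <- s) c j * z ^+ m j : Cplx R)); last exact: IH.
  apply: (@continuousM _ _ (cst (c i)) (fun z : Cplx R => z ^+ m i : Cplx R)).
    exact: cst_continuous.
  exact: continuous_expC.
by apply: funext => z; rewrite big_cons.
Qed.

(** Continuity on the disc makes the function integrable on each circle of
    radius less than 1; this is the only regularity that the norm
    estimates use. *)
Definition disc_continuous f := forall z, normc z < 1 -> {for z, continuous f}.

Lemma continuous_on_circle f r : disc_continuous f -> 0 <= r < 1 ->
  continuous (fun t => normc (f (circle_point r t))).
Proof.
move=> cf /andP[r0 r1] t; apply: cvg_normc.
apply: (cvg_comp _ _ (@continuous_circle_point r t)); apply: cf.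
by rewrite normc_circle_point.
Qed.

Lemma hardy_norm_le f (C : R) : disc_continuous f ->
  (forall r, 0 <= r < 1 ->
    circle_int (fun t => normc (f (circle_point r t))) <= 2 * pi * C) ->
  (hardy_norm f <= C%:E)%E.
Proof.
move=> cf fC; apply: ge_ereal_sup => _ [r /= r01 <-].
rewrite -(EFin_circle_int (continuous_on_circle cf r01)) -EFinM lee_fin.
by rewrite ler_pdivrMl ?two_pi_gt0// fC.
Qed.

Lemma circle_int_le_hardy f r (C : R) : disc_continuous f -> 0 <= r < 1 ->
  (hardy_norm f <= C%:E)%E ->
  circle_int (fun t => normc (f (circle_point r t))) <= 2 * pi * C.
Proof.
move=> cf r01 fC; rewrite -ler_pdivrMl ?two_pi_gt0// -lee_fin.
apply: le_trans fC; apply: ereal_sup_ubound; exists r => //.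
by rewrite EFinM (EFin_circle_int (continuous_on_circle cf r01)).
Qed.

Lemma parseval (n : nat) (c : nat -> R) :
  circle_int (fun t => (\sum_(k < n) c k * cos (k%:R * t)) ^+ 2 +
                       (\sum_(k < n) c k * sin (k%:R * t)) ^+ 2) =
  2 * pi * \sum_(k < n) c k ^+ 2.
Proof.
pose e (k l : nat) t : R := cos (k%:R * t) * cos (l%:R * t) +
                            sin (k%:R * t) * sin (l%:R * t).
have ce k l : continuous (e k l).
  move=> t; apply: cvgD; apply: cvgM;
    [exact: continuous_cosM|exact: continuous_cosM
    |exact: continuous_sinM|exact: continuous_sinM].
have cce x k l : continuous (fun t => x * e k l t).
  by move=> t; apply: cvgM; [exact: cvg_cst|exact: ce].
transitivity (circle_int (fun t => \sum_(k < n) \sum_(l < n) c k * c l * e k l t)).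
  congr circle_int; apply: funext => t; rewrite !expr2 !big_distrlr/= -big_split/=.
  apply: eq_bigr => k _; rewrite -big_split/=; apply: eq_bigr => l _.
  by rewrite /e; ring.
rewrite circle_int_sum; last by move=> k; apply: continuous_sum => l; exact: cce.
rewrite mulr_sumr; apply: eq_bigr => k _.
rewrite circle_int_sum; last by move=> l; exact: cce.
rewrite (bigD1 k)//= big1 ?addr0 => [|l lk]; rewrite circle_intZ// circle_int_cos.
  by rewrite eqxx; ring.
by rewrite ifN ?mulr0// eq_sym.
Qed.

(** By Parseval the integral is 2 pi times the sum of the r ^ (2 k) for
    k < n. *)
Lemma circle_int_dirichlet r n : 0 <= r < 1 ->
  circle_int (fun t => normc (\sum_(k < n) circle_point r t ^+ k) ^+ 2)
    <= 2 * pi * n%:R.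
Proof.
move=> /andP[r0 r1]; under eq_fun => t.
  under eq_bigr do rewrite circle_pointX.
  rewrite sum_complex sqr_normc/=; over.
rewrite parseval ler_wpM2l ?(ltW (two_pi_gt0 R))//.
apply: (@le_trans _ _ (\sum_(k < n) 1)); last by rewrite sumr_const card_ord.
by apply: ler_sum => k _; rewrite -exprM exprn_ile1// ltW.
Qed.

Lemma continuous_sum_sin n (d : nat -> R) :
  continuous (fun t => \sum_(l < n) d l * sin (l%:R * t)).
Proof.
apply: continuous_sum => l t; apply: cvgM; [exact: cvg_cst|exact: continuous_sinM].
Qed.

(** Hardy's inequality for polynomials.  A rotation by N t turns the polynomial
    into the sum of the c_l r ^ (N - l) e^(- i l t) without changing its
    modulus, and the sawtooth pi - t, bounded by pi, pairs the imaginary part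
    with 1 / l. *)
Lemma hardy_pairing (c : nat -> R) N n r : (n <= N.+1)%N -> 0 <= r < 1 ->
  2 * \sum_(l < n) c l * r ^+ (N - l) / l%:R <=
  circle_int (fun t => normc (\sum_(l < n) (c l)%:C * circle_point r t ^+ (N - l))).
Proof.
move=> nN r01; pose d l := c l * r ^+ (N - l).
set F := fun t => normc _.
have cF : continuous F.
  apply: (@continuous_on_circle (fun z => \sum_(l < n) (c l)%:C * z ^+ (N - l))) => //.
  by move=> z _; exact: continuous_monomials.
have cS := @continuous_sum_sin n d.
(* Dividing by [e^(i N t)] moves the top exponent [N] to frequency 0. *)
have SF t : `|\sum_(l < n) d l * sin (l%:R * t)| <= F t.
  pose E : Cplx R := circle_point 1 (N%:R * t).
  have -> : F t = normc (\sum_(l < n)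
      (d l * cos (l%:R * t) +i* - (d l * sin (l%:R * t)) : Cplx R)).
    set S : Cplx R := (X in _ = normc X).
    have -> : normc S = normc (E * S) by rewrite normcM normc_circle_point ?mul1r.
    rewrite mulr_sumr; congr normc; apply: eq_bigr => l _; rewrite circle_pointX.
    have lN : (l <= N)%N by rewrite -ltnS (leq_trans (ltn_ord l)).
    rewrite natrB// mulrBl /circle_point cosB sinB /d.
    by apply/eqP; rewrite eq_complex/=; apply/andP; split; apply/eqP; ring.
  apply: le_trans (ler_Im_normc _); rewrite sum_complex/= sumrN normrN.
  exact: lexx.
rewrite -(ler_pM2l (pi_gt0 R)).
rewrite -circle_intZ//.
(* The sum on the left is the pairing of the imaginary part with [pi - t]. *)
apply: (@le_trans _ _ (circle_int (fun t =>
    (pi - t) * \sum_(l < n) d l * sin (l%:R * t)))).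
  under [X in _ <= circle_int X]eq_fun => t.
    rewrite mulr_sumr; under eq_bigr do rewrite mulrCA.
    over.
  rewrite circle_int_sum; last first.
    move=> l t; apply: cvgM; first exact: cvg_cst.
    apply: cvgM; last exact: continuous_sinM.
    by apply: cvgB; [exact: cvg_cst|exact: cvg_id].
  rewrite mulrA mulr_sumr; apply: ler_sum => l _; rewrite circle_intZ; last first.
    move=> t; apply: cvgM; last exact: continuous_sinM.
    by apply: cvgB; [exact: cvg_cst|exact: cvg_id].
  by rewrite circle_int_sawtooth_sin /d le_eqVlt; apply/orP; left; apply/eqP; ring.
apply: circle_int_le.
- move=> t; apply: cvgM; last exact: cS.
  by apply: cvgB; [exact: cvg_cst|exact: cvg_id].
- by move=> t; apply: cvgM; [exact: cvg_cst|exact: cF].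
move=> t /andP[t0 t2]; apply: le_trans (ler_norm _) _; rewrite normrM.
apply: ler_pM => //; rewrite ler_norml; lra.
Qed.
End CircleMeans.

(** * A lacunary series of Fejer kernels *)

Section Example.
Variable R : realType.
Implicit Types (z : Cplx R) (r : R).

Definition block_size (j : nat) : nat := 2 ^ 2 ^ j.

Definition dirichlet_poly (M : nat) : {poly R[i]} := \poly_(i < M) 1.

(** Up to the factor 1 / M, the Fejer kernel multiplied by z ^ (3 M - 1).  Its
    exponents run from 2 M to 4 M - 2. *)
Definition shifted_fejer (M : nat) : {poly R[i]} :=
  'X^(2 * M) * dirichlet_poly M ^+ 2.

(** The amplitude 2^-j of the j-th block, together with the normalization
    1 / M of the kernel. *)
Definition block_weight (j : nat) : R := 2^-1 ^+ j / (block_size j)%:R.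

Definition lacunary_poly (J : nat) : {poly R[i]} :=
  \sum_(j < J) (block_weight j)%:C *: shifted_fejer (block_size j).

(** The k-th coefficient does not change once the index of the polynomial
    exceeds k, since the exponents of block j are larger than j. *)
Definition example_coef (k : nat) : Cplx R := (lacunary_poly k.+1)`_k.

Lemma block_size_gt0 j : (0 < block_size j)%N.
Proof. by rewrite expn_gt0. Qed.

Lemma block_weight_ge0 j : 0 <= block_weight j.
Proof. by rewrite divr_ge0// exprn_ge0// invr_ge0. Qed.

Lemma ltn_block_size j : (j < block_size j)%N.
Proof. exact: leq_trans (ltn_expl _ _) (ltnW (ltn_expl _ _)). Qed.

Lemma block_size_sep i j : (i < j)%N -> (2 * block_size i <= block_size j)%N.
Proof.
move=> ij; rewrite /block_size -expnS leq_exp2l//.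
have : (2 ^ i.+1 <= 2 ^ j)%N by rewrite leq_exp2l.
by rewrite expnS; have := expn_gt0 2 i; lia.
Qed.

Lemma block_size_mono i j : (i <= j)%N -> (block_size i <= block_size j)%N.
Proof. by move=> ij; rewrite /block_size !leq_exp2l. Qed.

Lemma coef_shifted_fejer_low M k : (k < 2 * M)%N -> (shifted_fejer M)`_k = 0.
Proof. by move=> kM; rewrite coefXnM kM. Qed.

Lemma coef_shifted_fejer_high M k : (0 < M)%N -> (4 * M <= k)%N ->
  (shifted_fejer M)`_k = 0.
Proof.
move=> M0 kM; rewrite coefXnM; case: ifP => // _; apply: nth_default.
apply: leq_trans (size_poly_exp_leq _ _) _.
have := size_poly M (fun _ => 1 : R[i]); rewrite -/(dirichlet_poly M).
by case: (size _) => [|s]/=; lia.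
Qed.

Lemma coef_shifted_fejer M l : (l < M)%N ->
  (shifted_fejer M)`_(2 * M + l) = l.+1%:R.
Proof.
move=> lM; rewrite coefXnM ltnNge leq_addr/= addKn expr2 coefM.
rewrite (eq_bigr (fun=> 1)) ?sumr_const ?card_ord// => i _.
have := ltn_ord i; rewrite !coef_poly => il.
by rewrite !ifT ?mulr1//; lia.
Qed.

Lemma normc_coef_fejer_le M k : (0 < M)%N ->
  normc (shifted_fejer M)`_k <= 2 * M%:R.
Proof.
move=> M0; have [kM|kM] := leqP (4 * M) k.
  by rewrite coef_shifted_fejer_high// normc0 mulr_ge0.
rewrite coefXnM; case: ifP => [_|/negbT]; first by rewrite normc0 mulr_ge0.
rewrite -leqNgt => Mk; rewrite expr2 coefM.
apply: le_trans (le_normc_sum _ _ _) _.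
apply: (@le_trans _ _ (\sum_(i < (k - 2 * M).+1) 1)).
  apply: ler_sum => i _; rewrite normcM -[leRHS]mulr1 !coef_poly.
  by apply: ler_pM; rewrite ?normc_ge0//; case: ifP; rewrite ?normc1 ?normc0.
by rewrite sumr_const card_ord -natrM ler_nat; lia.
Qed.

Lemma horner_shifted_fejer M z :
  (shifted_fejer M).[z] = z ^+ (2 * M) * (\sum_(k < M) z ^+ k) ^+ 2.
Proof.
rewrite /shifted_fejer hornerM hornerXn horner_exp horner_poly.
by under eq_bigr do rewrite mul1r.
Qed.

Lemma sum_halves_le J : \sum_(j < J) 2^-1 ^+ j <= 2 :> R.
Proof.
rewrite -(big_mkord xpredT (fun j => 2^-1 ^+ j)).
apply: le_trans (sum_geometric_le _ (leq0n J)) _; first lra.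
rewrite expr0 ler_pdivrMr; lra.
Qed.

Lemma size_lacunary J : (size (lacunary_poly J) <= 2 * block_size J)%N.
Proof.
apply/leq_sizeP => k kJ; rewrite coef_sum big1// => j _.
rewrite coefZ coef_shifted_fejer_high ?mulr0 ?block_size_gt0//.
by have := block_size_sep (ltn_ord j); lia.
Qed.

Lemma coef_lacunary_stable J K k : (J <= K)%N -> (k < 2 * block_size J)%N ->
  (lacunary_poly K)`_k = (lacunary_poly J)`_k.
Proof.
move=> JK; rewrite -(subnKC JK) => kJ; elim: (K - J)%N => [|d IH].
  by rewrite addn0.
rewrite addnS /lacunary_poly big_ord_recr/= coefD IH coefZ.
rewrite coef_shifted_fejer_low ?mulr0 ?addr0//.
by have := block_size_mono (leq_addr d J); lia.
Qed.

Lemma example_coefE J k : (k < 2 * block_size J)%N ->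
  example_coef k = (lacunary_poly J)`_k.
Proof.
move=> kJ; rewrite /example_coef.
have [Jk|Jk] := leqP J k.+1; first exact: coef_lacunary_stable.
rewrite (@coef_lacunary_stable k.+1 J)//; first exact: ltnW.
by have := ltn_block_size k.+1; lia.
Qed.

Lemma psum_example J z : psum example_coef (2 * block_size J) z = (lacunary_poly J).[z].
Proof.
rewrite (horner_coef_wide _ (size_lacunary J)) /psum big_mkord.
by apply: eq_bigr => k _; rewrite (@example_coefE J).
Qed.

Lemma normc_example_coef k : normc (example_coef k) <= 4.
Proof.
rewrite /example_coef coef_sum; apply: le_trans (le_normc_sum _ _ _) _.
apply: (@le_trans _ _ (\sum_(j < k.+1) 2 * 2^-1 ^+ j)).
  apply: ler_sum => j _; rewrite coefZ normcM normc_real ?block_weight_ge0//.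
  apply: le_trans (ler_wpM2l (block_weight_ge0 _)
    (normc_coef_fejer_le _ (block_size_gt0 _))) _.
  rewrite /block_weight mulrCA divfK ?pnatr_eq0 -?lt0n ?block_size_gt0//.
rewrite -mulr_sumr; have := sum_halves_le k.+1; lra.
Qed.

(** On the lower half of block J, only that block contributes. *)
Lemma example_coef_window J l : (l < block_size J)%N ->
  example_coef (2 * block_size J + l) = (block_weight J * l.+1%:R)%:C.
Proof.
move=> lM; rewrite (@example_coefE J.+1); last first.
  by have := block_size_sep (ltnSn J); lia.
rewrite /lacunary_poly big_ord_recr/= coefD -/(lacunary_poly J).
rewrite nth_default ?add0r; last exact: leq_trans (size_lacunary J) (leq_addr _ _).
by rewrite coefZ coef_shifted_fejer// [RHS](rmorphM (real_complex R))/= rmorph_nat.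
Qed.

Definition example : Cplx R -> Cplx R := power_sum example_coef.

Lemma example_disc_continuous : disc_continuous example.
Proof. by move=> z z1; exact: (power_sum_continuous normc_example_coef). Qed.

Lemma normc_lacunary_le J z : normc z <= 1 ->
  normc (lacunary_poly J).[z] <=
  \sum_(j < J) block_weight j * normc (\sum_(k < block_size j) z ^+ k) ^+ 2.
Proof.
move=> z1; rewrite horner_sum; apply: le_trans (le_normc_sum _ _ _) _.
apply: ler_sum => j _; rewrite hornerZ normcM normc_real ?block_weight_ge0//.
rewrite ler_wpM2l ?block_weight_ge0// horner_shifted_fejer normcM !normcX.
by rewrite -[leRHS]mul1r ler_wpM2r ?exprn_ge0 ?normc_ge0// exprn_ile1 ?normc_ge0.
Qed.

Lemma small_power r (e : R) : 0 <= r < 1 -> 0 < e -> exists n, r ^+ n <= e.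
Proof.
move=> /andP[r0 r1] e0.
have : geometric 1 r x @[x --> \oo] --> 0 by apply: cvg_geometric; rewrite ger0_norm.
move=> /cvgr_le /(_ _ e0)[n _ /(_ n (leqnn n))].
by rewrite /geometric/= mul1r => rn; exists n.
Qed.

(** On a circle of radius r, the function is within 1 of a polynomial made of
    whole blocks, and these have mean at most 2 in total. *)
Lemma example_hardy : hardy_space example.
Proof.
split=> [z z1|].
  apply: (power_sum_derivable normc_example_coef).
  by move: z1; rewrite /unit_disc/= normE_normc ltcR.
apply: (@le_lt_trans _ _ 3%:E); last exact: ltry.
apply: (hardy_norm_le example_disc_continuous) => r /[dup] r01 /andP[r0 r1].
have [J rJ] : exists J, r ^+ J <= (1 - r) / 4.
  by apply: small_power => //; rewrite divr_gt0// subr_gt0.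
pose D j t := normc (\sum_(k < block_size j) (circle_point r t : Cplx R) ^+ k) ^+ 2.
have cD j : continuous (D j).
  pose Q z : Cplx R := \sum_(k < block_size j) 1 * z ^+ k.
  have cN : continuous (fun t => normc (Q (circle_point r t))).
    by apply: continuous_on_circle => // z _; exact: continuous_monomials.
  rewrite (_ : D j = fun t => normc (Q (circle_point r t)) ^+ 2).
    by move=> t; exact: (cvg_comp _ _ (cN t) (@exprn_continuous _ 2 _)).
  by apply: funext => t; rewrite /D /Q; under [in RHS]eq_bigr do rewrite mul1r.
have cwD j : continuous (fun t => block_weight j * D j t).
  by move=> t; apply: cvgM; [exact: cvg_cst|exact: cD].
apply: (@le_trans _ _ (circle_int (fun t => \sum_(j < J) block_weight j * D j t + 1))).
  apply: circle_int_le.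
  - exact: continuous_on_circle example_disc_continuous r01.
  - by move=> t; apply: cvgD; [exact: continuous_sum|exact: cvg_cst].
  move=> t _; set z : Cplx R := circle_point r t.
  have zr : normc z = r by rewrite normc_circle_point.
  rewrite -(subrK (lacunary_poly J).[z] (example z)) addrC.
  apply: le_trans (le_normcD _ _) (lerD _ _).
    by apply: normc_lacunary_le; rewrite zr ltW.
  rewrite -psum_example.
  apply: le_trans (power_sum_tail _ normc_example_coef _) _; rewrite zr//.
  rewrite ler_pdivrMr ?subr_gt0// mul1r mulrC -ler_pdivlMr//.
  apply: le_trans rJ; apply: ler_wiXn2l => //; first exact: ltW.
  by have := ltn_block_size J; lia.
rewrite circle_intD; last 2 first.
- exact: continuous_sum.
- by move=> t; exact: cvg_cst.
rewrite circle_int_cst circle_int_sum//.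
apply: (@le_trans _ _ (\sum_(j < J) (2 * pi) * 2^-1 ^+ j + 2 * pi * 1)).
  rewrite lerD2r; apply: ler_sum => j _.
  rewrite circle_intZ//.
  apply: le_trans (ler_wpM2l (block_weight_ge0 _) (circle_int_dirichlet _ r01)) _.
  by rewrite /block_weight mulrCA divfK ?pnatr_eq0 -?lt0n ?block_size_gt0.
rewrite -mulr_sumr -mulrDr ler_wpM2l ?(ltW (two_pi_gt0 R))//.
have := sum_halves_le J; lra.
Qed.

(** The terms with 2 ^ p <= l < 2 ^ (p + 1) add at least 1 / 2.  The term l = 0
    is 0. *)
Lemma harmonic_dyadic_ge p : p%:R / 2 <= \sum_(0 <= l < 2 ^ p) l%:R^-1 :> R.
Proof.
elim: p => [|p IH]; first by rewrite mul0r big_nat1 invr0.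
rewrite (big_cat_nat (leq0n (2 ^ p)))/=; last by rewrite leq_exp2l.
rewrite -natr1 mulrDl; apply: lerD => //.
apply: (@le_trans _ _ (\sum_(2 ^ p <= l < 2 ^ p.+1) (2 ^ p.+1)%:R^-1)).
  rewrite sumr_const_nat.
  have -> : (2 ^ p.+1 - 2 ^ p = 2 ^ p)%N by rewrite expnS; lia.
  rewrite expnS natrM invfM -[leRHS]mulr_natl mulrCA divff ?mulr1 ?div1r//.
apply: ler_sum_nat => l /andP[l1 l2]; rewrite lef_pV2 ?posrE ?ltr0n ?expn_gt0//.
  by rewrite ler_nat ltnW.
by apply: leq_trans l1; rewrite expn_gt0.
Qed.

(** A radius so close to 1 that r ^ n costs at most a factor 2; it depends on n,
    which is harmless as the norm is a supremum over r. *)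
Lemma bernoulli_half n : exists2 r : R, 0 <= r < 1 & 2^-1 <= r ^+ n.
Proof.
pose x : R := (2 * n.+1%:R)^-1.
have x0 : 0 < x by rewrite invr_gt0 mulr_gt0.
have nx : n.+1%:R * x = 2^-1 by rewrite /x invfM mulrCA divff ?mulr1.
have x1 : x <= 2^-1.
  by rewrite -nx ler_peMl ?ler1n// ltW.
exists (1 - x); first by apply/andP; split; lra.
have H m : 1 - m%:R * x <= (1 - x) ^+ m.
  elim: m => [|m IH]; first by rewrite mul0r subr0 expr0.
  rewrite exprS; apply: le_trans (ler_wpM2l _ IH); last lra.
  rewrite -natr1.
  have : 0 <= m%:R * x * x by rewrite !mulr_ge0// ltW.
  lra.
apply: le_trans (H n).
have : n%:R * x <= n.+1%:R * x by rewrite ler_wpM2r ?ler_nat// ltW.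
rewrite nx; lra.
Qed.

(** The partial sums cut at the start and in the middle of block J stay apart:
    the harmonic sum over l < 2 ^ 2 ^ J is at least 2 ^ J / 2,
    which compensates the amplitude 2^-J. *)
Lemma example_window_ge J : (2 <= J)%N -> exists2 r : R, 0 <= r < 1 &
  4^-1 <= circle_int (fun t =>
    normc (psum example_coef (3 * block_size J) (circle_point r t) -
           psum example_coef (2 * block_size J) (circle_point r t))).
Proof.
move=> J2; set M := block_size J; have M0 : (0 < M)%N := block_size_gt0 J.
have [r r01 rN] := bernoulli_half (3 * M).-1; exists r => //.
(* Coefficients of the window, indexed downwards from the top exponent. *)
pose c l : R := block_weight J * (M - l)%:R.
have MN : (M <= (3 * M).-1.+1)%N by lia.
have := hardy_pairing c MN r01.
under [X in _ <= circle_int X]eq_fun => t.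
  rewrite (_ : \sum_(l < M) _ = psum example_coef (3 * M) (circle_point r t) -
           psum example_coef (2 * M) (circle_point r t)); last first.
    rewrite /psum (@big_cat_nat _ _ _ (2 * M) 0 (3 * M))//=; last lia.
    rewrite [RHS]addrAC subrr add0r -[(2 * M)%N]add0n big_addn.
    rewrite (_ : (3 * M - 2 * M)%N = M); last lia.
    rewrite big_nat_rev big_mkord; apply: eq_bigr => l _.
    have lM := ltn_ord l.
    rewrite add0n (_ : (M - l.+1 + 2 * M) = (2 * M + (M - l.+1)))%N; last lia.
    rewrite example_coef_window -/M; last lia.
    rewrite /c; congr (_ * _ ^+ _); last lia.
    by congr ((_ * _%:R)%:C); lia.
  over.
apply: le_trans.
have wM : block_weight J * M%:R = 2^-1 ^+ J.
  by rewrite divfK ?pnatr_eq0 -?lt0n.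
apply: (@le_trans _ _ (\sum_(0 <= l < M) 2^-1 ^+ J * (l%:R^-1 - M%:R^-1))).
  rewrite -mulr_sumr sumrB sumr_const_nat subn0.
  rewrite -[_^-1 *+ M]mulr_natl divff ?pnatr_eq0 -?lt0n//.
  apply: (@le_trans _ _ (2^-1 ^+ J * ((2 ^ J)%:R / 2 - 1))).
    rewrite mulrBr mulr1 mulrA natrX -exprMn mulVf// expr1n mul1r.
    have : 2^-1 ^+ J <= 2^-1 ^+ 2 :> R by apply: ler_wiXn2l => //; lra.
    rewrite expr2; lra.
  rewrite ler_wpM2l ?exprn_ge0 ?invr_ge0// lerD2r; exact: harmonic_dyadic_ge.
rewrite big_mkord mulr_sumr; apply: ler_sum => l _.
(* At [l = 0] the inverse is 0 and the bound is negative. *)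
have [->|l0] := posnP l.
  rewrite invr0 !mulr0 sub0r mulrN oppr_le0 mulr_ge0 ?exprn_ge0//.
have lM := ltn_ord l.
rewrite /c -wM (natrB _ (ltnW lM)).
have -> : block_weight J * M%:R * (l%:R^-1 - M%:R^-1) =
    2 * (block_weight J * (M%:R - l%:R) * 2^-1 / l%:R).
  field.
  by rewrite !pnatr_eq0 -!lt0n l0 M0.
rewrite ler_wpM2l// ler_wpM2r ?invr_ge0// ler_wpM2l//.
  by rewrite mulr_ge0 ?block_weight_ge0// subr_ge0 ler_nat ltnW.
case/andP: r01 => r0 r1.
by apply: le_trans rN _; apply: ler_wiXn2l; [|exact: ltW|lia].
Qed.

End Example.

(** * Partial sums are not Cauchy *)

Section Main.
Variable R : realType.

Lemma holomorphic_disc_continuous (h : Cplx R -> Cplx R) :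
  holomorphic_on (@unit_disc R) h -> disc_continuous h.
Proof.
move=> hol z z1; apply/differentiable_continuous/derivable1_diffP/hol.
by rewrite /unit_disc/= normE_normc ltcR.
Qed.

(** The triangle inequality on each circle.  It needs the limit to be
    measurable there, which holds because a holomorphic function is
    continuous. *)
Lemma converges_in_hardy_cauchy (F : nat -> Cplx R -> Cplx R) (e : R) :
  (forall N, continuous (F N)) -> converges_in_hardy F -> 0 < e ->
  exists N, forall m n, (N <= m)%N -> (N <= n)%N -> forall r, 0 <= r < 1 ->
    circle_int (fun t => normc (F m (circle_point r t) - F n (circle_point r t)))
      <= e.
Proof.
move=> cF [h [[hol _] Fh]] e0.
(* Two distances to the limit, each integrated over a length [2 * pi]. *)
pose d := e / (4 * pi).
have d0 : 0 < d by rewrite divr_gt0// mulr_gt0// pi_gt0.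
have [N _ FN] : \forall n \near \oo, (hardy_norm (fun z => F n z - h z)%R <= d%:E)%E.
  move/fine_cvgP : Fh => [Ffin /cvgr_le /(_ _ d0) Fd].
  by apply: filterS2 Ffin Fd => n fin; rewrite -lee_fin fineK.
have cFh n : disc_continuous (fun z => F n z - h z).
  move=> z z1; apply: (@continuousB _ _ _ (F n) h); first exact: cF.
  exact: holomorphic_disc_continuous.
exists N => m n Nm Nn r r01.
have im := circle_int_le_hardy (cFh m) r01 (FN m Nm).
have iN := circle_int_le_hardy (cFh n) r01 (FN n Nn).
have cm := continuous_on_circle (cFh m) r01.
have cn := continuous_on_circle (cFh n) r01.
apply: (@le_trans _ _ (2 * pi * d + 2 * pi * d)).
  apply: le_trans (lerD im iN); rewrite -circle_intD//.
  apply: circle_int_le.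
  - apply: (@continuous_on_circle _ (fun z => F m z - F n z)) r01 => z _.
    exact: (continuousB (cF m z) (cF n z)).
  - by move=> t; apply: cvgD; [exact: cm|exact: cn].
  move=> t _; set z : Cplx R := circle_point r t.
  rewrite (normcB (F n z)) (_ : F m z - F n z = (F m z - h z) + (h z - F n z)).
    exact: le_normcD.
  by rewrite addrA subrK.
have pi0 : pi != 0 :> R by rewrite gt_eqF// pi_gt0.
suff -> : 2 * pi * d + 2 * pi * d = e by [].
by rewrite /d; move: (pi : R) pi0 => p p0; field.
Qed.
End Main.

Theorem theorem2p2 (R : realType) :
  exists (g : Cplx R -> Cplx R) (a : nat -> Cplx R),
    [/\ hardy_space g,
        has_power_series g a &
        ~ converges_in_hardy (partial_sum a)].
Proof.
exists (@example R), (@example_coef R); split.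
- exact: example_hardy.
- move=> z z1; apply: (psum_cvg (@normc_example_coef R)).
  by move: z1; rewrite /unit_disc/= normE_normc ltcR.
move=> /(@converges_in_hardy_cauchy _ _ 5^-1) [N||N HN].
- exact: continuous_monomials.
- by rewrite invr_gt0.
pose J := maxn 2 N.
have [r r01] := @example_window_ge R J (leq_maxl 2 N).
have NJ : (N < block_size J)%N := leq_ltn_trans (leq_maxr 2 N) (ltn_block_size J).
have := HN (3 * block_size J).-1 (2 * block_size J).-1 _ _ r r01.
rewrite /partial_sum !prednK ?muln_gt0 ?block_size_gt0//.
move=> up lo; suff : 4^-1 <= 5^-1 :> R by lra.
by apply: le_trans lo (up _ _); lia.
Qed.
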